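(* Every invariant almost complex structure $J$ on an isotropy irreducible flag manifold $\mathbb F_\Theta$, i.e. one with $|R_t^+|=1$, is an invariant complex structure.
   Context: $\mathfrak g$ is a finite-dimensional complex semisimple Lie algebra, $\mathfrak h$ a Cartan subalgebra, $R$ the root system, $B$ the Killing form, $H_\alpha\in\mathfrak h$ the element with $\alpha(X)=B(X,H_\alpha)$, $\mathfrak h_{\mathbb R}$ the real span of the $H_\alpha$, $\Sigma$ a simple system, $R^\pm$ the positive/negative roots. For $\Theta\subset\Sigma$: $R_\Theta=\langle\Theta\rangle\cap R$, $R_\Theta^{\pm}=R_\Theta\cap R^{\pm}$, $R_M=R\setminus R_\Theta$, $R_M^+=R_M\cap R^+$. $G$ is a Lie group with Lie algebra $\mathfrak g$, $P_\Theta$ the normalizer in $G$ of $\mathfrak p_\Theta=\mathfrak h\oplus\sum_{\alpha\in R^+}\mathfrak g_\alpha\oplus\sum_{\alpha\in R_\Theta^-}\mathfrak g_\alpha$, and $\mathbb F_\Theta=G/P_\Theta$. Fix a Weyl basis $X_\alpha\in\mathfrak g_\alpha$ ($B(X_\alpha,X_{-\alpha})=1$, $[X_\alpha,X_\beta]=n_{\alpha,\beta}X_{\alpha+\beta}$ with $n_{\alpha,\beta}$ real and nonzero iff $\alpha+\beta\in R$, $n_{\alpha,\beta}=-n_{-\alpha,-\beta}$). Put $\mathfrak u_\alpha=\mathrm{span}_{\mathbb R}\{X_\alpha-X_{-\alpha},\,i(X_\alpha+X_{-\alpha})\}$, $\mathfrak u=i\mathfrak h_{\mathbb R}\oplus\sum_{\alpha\in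 R^+}\mathfrak u_\alpha$ (a compact real form), $U\subset G$ the corresponding compact group, $K_\Theta=P_\Theta\cap U$, with Lie algebra $\mathfrak k_\Theta=i\mathfrak h_{\mathbb R}\oplus\sum_{\alpha\in R_\Theta^+}\mathfrak u_\alpha$. Then $\mathbb F_\Theta=U/K_\Theta$ with tangent space at the origin $\mathfrak m=\sum_{\alpha\in R_M^+}\mathfrak u_\alpha$. Put $\mathfrak t=\{H\in i\mathfrak h_{\mathbb R}:\alpha(H)=0\ \forall\alpha\in R_\Theta\}$, $k(\alpha)=\alpha|_{\mathfrak t}$; the t-roots are $R_t=k(R_M)$ and $R_t^+=k(R_M^+)$. The irreducible $\mathrm{ad}(\mathfrak k_\Theta)$-submodules of $\mathfrak m$ are in bijection with $R_t^+$. An invariant almost complex structure is (equivalent to) a linear map $J:\mathfrak m\to\mathfrak m$ with $J^2=-\mathrm{Id}$ commuting with $\mathrm{ad}(L)$ for all $L\in\mathfrak k_\Theta$. It is an invariant complex structure (integrable) if its Nijenhuis tensor vanishes: $-\tfrac12N(X,Y)=-[JX,JY]+[X,Y]+J[X,JY]+J[JX,Y]=0$ for all $X,Y\in\mathfrak m$ (brackets projected to $\mathfrak m$). *)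

(* Defs.v *)
From HB Require Import structures.
From mathcomp Require Import all_boot all_order all_algebra complex.
From mathcomp Require Import boolp classical_sets functions cardinality reals.

Set Implicit Arguments.
Unset Strict Implicit.
Unset Printing Implicit Defensive.

Import Order.TTheory GRing.Theory Num.Theory.
Local Open Scope ring_scope.
Local Open Scope complex_scope.
Local Open Scope classical_set_scope.

HB.mixin Record Vector_isLieAlgebra (K : fieldType) L of Vector K L := {
  lie : L -> L -> L;
  lie_linearr : forall x, linear (lie x);
  lie_linearl : forall y, linear (lie^~ y);
  liexx : forall x, lie x x = 0;
  lie_jacobi : forall x y z,
    lie x (lie y z) + lie y (lie z x) + lie z (lie x y) = 0
}.

#[short(type="lieAlgType")]
HB.structure Definition LieAlgebra (K : fieldType) :=
  {L of Vector K L & Vector_isLieAlgebra K L}.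

Section LieAlgebraTheory.
Variables (K : fieldType) (L : lieAlgType K).
Implicit Types (x y : L) (U V I h : {vspace L}).

Definition ad x : 'End(L) := linfun (lie x).

Definition killing x y : K := let e := vbasis {: L} in \tr (passmx.mxof e e (ad x \o ad y)%VF).

Definition liev U V : {vspace L} :=
  <<[seq lie x y | x <- vbasis U, y <- vbasis V]>>%VS.

Definition derived_series I n : {vspace L} := iter n (fun V => liev V V) I.
Definition lower_central_series I n : {vspace L} := iter n (liev I) I.

Definition subalgebra U : Prop :=
  forall x y, x \in U -> y \in U -> lie x y \in U.
Definition ideal I : Prop := forall x y, y \in I -> lie x y \in I.
Definition solvable I : Prop := exists n, derived_series I n = 0%VS.
Definition nilpotent I : Prop := exists n, lower_central_series I n = 0%VS.

Definition semisimple : Prop :=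
  forall I, ideal I -> solvable I -> I = 0%VS.

Definition cartan_subalgebra h : Prop :=
  [/\ subalgebra h, nilpotent h &
      forall x, (forall y, y \in h -> lie x y \in h) -> x \in h].

End LieAlgebraTheory.

Section Roots.
Variables (K : fieldType) (L : lieAlgType K) (h : {vspace L}).

Definition cartan_dual := 'Hom(subvs_of h, K^o).
Implicit Types (a b : cartan_dual) (S : seq cartan_dual).

(* The value a(H), meaningful for H in h. *)
Definition dual_eval a (H : L) : K := a (vsproj h H).

Definition root_space a : set L :=
  [set X | forall H, H \in h -> lie H X = dual_eval a H *: X].

Definition lie_root a : Prop := a != 0 /\ exists2 X, X != 0 & root_space a X.

(* H_a, the element of h representing a for the Killing form. *)
Definition Hroot a : L :=
  xget 0 [set H | H \in h /\
                  forall X, X \in h -> dual_eval a X = killing X H].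

Definition positive_root S a : Prop :=
  lie_root a /\
  exists c : 'I_(size S) -> nat, a = \sum_(i < size S) S`_i *+ c i.

Definition simple_system S : Prop :=
  [/\ free S, forall a, a \in S -> lie_root a &
      forall a, lie_root a -> positive_root S a \/ positive_root S (- a)].

End Roots.

Section Flag.
Variables (R : realType) (L : lieAlgType R[i]) (h : {vspace L}).
Implicit Types (a b : cartan_dual h) (A : set L).

(* The X a with a not a root are irrelevant; the convention n a b = 0 when
   a + b is not a root makes the bracket relation hold for all roots a, b
   with a + b != 0. *)
Record weyl_basis (X : cartan_dual h -> L)
    (n : cartan_dual h -> cartan_dual h -> R) : Prop := WeylBasis {
  weyl_basis_of : exists s : seq (cartan_dual h),
    [/\ uniq s, forall a, a \in s <-> lie_root a &
        basis_of fullv (vbasis h ++ [seq X a | a <- s])];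
  weyl_root_space : forall a, lie_root a -> root_space a (X a);
  weyl_killing : forall a, lie_root a -> killing (X a) (X (- a)) = 1;
  weyl_lie : forall a b, lie_root a -> lie_root b -> a + b != 0 ->
    lie (X a) (X b) = (n a b)%:C *: X (a + b);
  weyl_neq0 : forall a b, lie_root a -> lie_root b ->
    (n a b != 0 <-> lie_root (a + b));
  weyl_opp : forall a b, lie_root a -> lie_root b -> n a b = - n (- a) (- b)
}.

Definition real_span A : set L :=
  [set v | exists m (c : 'I_m -> R) (w : 'I_m -> L),
     (forall i, A (w i)) /\ v = \sum_(i < m) (c i)%:C *: w i].

Definition h_R : set L := real_span [set Hroot a | a in @lie_root _ L h].
Definition ih_R : set L := [set 'i *: H | H in h_R].

Definition u_root (X : cartan_dual h -> L) a : set L :=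
  real_span [set X a - X (- a); 'i *: (X a + X (- a))].

Variables (Sigma Theta : seq (cartan_dual h)).

Definition R_Theta : set (cartan_dual h) :=
  [set a | lie_root a /\ a \in <<Theta>>%VS].
Definition R_Theta_pos : set (cartan_dual h) :=
  R_Theta `&` positive_root Sigma.
Definition R_M : set (cartan_dual h) := @lie_root _ L h `\` R_Theta.
Definition R_M_pos : set (cartan_dual h) := R_M `&` positive_root Sigma.

Definition t_Theta : set L :=
  [set H | ih_R H /\ forall a, R_Theta a -> dual_eval a H = 0].

Definition k_restr a : t_Theta -> R[i] := sigL t_Theta (dual_eval a).

Definition t_roots : set (t_Theta -> R[i]) := k_restr @` R_M.
Definition t_roots_pos : set (t_Theta -> R[i]) := k_restr @` R_M_pos.

Definition isotropy_irreducible : Prop := (t_roots_pos #= `I_1)%card.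

Variable X : cartan_dual h -> L.

Definition k_Theta : set L :=
  real_span (ih_R `|` \bigcup_(a in R_Theta_pos) u_root X a).

Definition m_Theta : set L :=
  real_span (\bigcup_(a in R_M_pos) u_root X a).

(* The projection of u = k_Theta (+) m_Theta onto m_Theta along k_Theta. *)
Definition proj_m (z : L) : L :=
  xget 0 [set w | m_Theta w /\ k_Theta (z - w)].

Definition lie_m (x y : L) : L := proj_m (lie x y).

(* J is an R-linear endomorphism of m_Theta; its values outside m_Theta are
   irrelevant. *)
Record invariant_almost_complex (J : L -> L) : Prop := InvariantAlmostComplex {
  iac_stable : forall x, m_Theta x -> m_Theta (J x);
  iac_linear : forall (c : R) x y, m_Theta x -> m_Theta y ->
    J (c%:C *: x + y) = c%:C *: J x + J y;
  iac_square : forall x, m_Theta x -> J (J x) = - x;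
  iac_ad : forall z x, k_Theta z -> m_Theta x -> J (lie z x) = lie z (J x)
}.

Definition nijenhuis (J : L -> L) (x y : L) : L :=
  (- 2) *: (- lie_m (J x) (J y) + lie_m x y
            + J (lie_m x (J y)) + J (lie_m (J x) y)).

Definition invariant_complex (J : L -> L) : Prop :=
  invariant_almost_complex J /\
  forall x y, m_Theta x -> m_Theta y -> nijenhuis J x y = 0.

End Flag.

(* Main.v *)
(* For an isotropy irreducible flag manifold the projected bracket of m with m
   vanishes, so every term of the Nijenhuis tensor is zero. Let tau be the only
   positive t-root and choose H in t with tau(H) <> 0. Then ad H has the
   eigenvalues tau(H) and -tau(H) on m and kills k_Theta, hence
   k_Theta meets m trivially. For a, b in R_M^+, the sum a + b is not a root,
   because 2 tau(H) is not among 0, tau(H), -tau(H); and if a - b is a root, it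
   vanishes on H, hence lies in R_Theta. So [u_a, u_b] is contained in k_Theta.

   Such an H exists as soon as the values b(H_a) of the roots are real. For
   a <> b, -b this follows from the Jacobi identity and the real structure
   constants of the Weyl basis. The value b(H_b) would need the trace formula
   for the Killing form; instead, a root b with b(H_b) not real is shown to be
   orthogonal to all other roots except -b, and i H_b separates it directly. *)

From HB Require Import structures.
Require Import Defs.
From mathcomp Require Import all_boot all_order all_algebra complex.
From mathcomp Require Import boolp classical_sets functions cardinality reals.

Set Implicit Arguments.
Unset Strict Implicit.
Unset Printing Implicit Defensive.

Import Order.TTheory GRing.Theory Num.Theory.

Local Open Scope ring_scope.
Local Open Scope complex_scope.

(** * Bilinearity of the bracket; symmetry and invariance of the Killing form *)

Section LieBracket.
Variables (K : fieldType) (L : lieAlgType K).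
Implicit Types (x y z : L).

HB.instance Definition _ x := GRing.isLinear.Build K L L _ (lie x) (lie_linearr x).

Lemma lieC x y : lie x y = - lie y x.
Proof.
have linl (u v w : L) : lie (u + v) w = lie u w + lie v w.
  by have := lie_linearl w 1 u v; rewrite !scale1r.
apply/eqP; rewrite -addr_eq0; apply/eqP.
have := liexx (x + y); rewrite linl !linearD /= !liexx add0r addr0; apply.
Qed.

Lemma lieDr x y z : lie x (y + z) = lie x y + lie x z.
Proof. exact: linearD. Qed.

Lemma lieNr x y : lie x (- y) = - lie x y.
Proof. exact: linearN. Qed.

Lemma lieZr (c : K) x y : lie x (c *: y) = c *: lie x y.
Proof. exact: linearZ. Qed.

Lemma lie0r x : lie x 0 = 0.
Proof. exact: linear0. Qed.

Lemma lie_sumr I (r : seq I) (F : I -> L) x :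
  lie x (\sum_(i <- r) F i) = \sum_(i <- r) lie x (F i).
Proof. exact: linear_sum. Qed.

Lemma lieNl x y : lie (- x) y = - lie x y.
Proof. by rewrite lieC lieNr -lieC. Qed.

Lemma lie0l x : lie 0 x = 0.
Proof. by rewrite lieC lie0r oppr0. Qed.

Lemma lieDl x y z : lie (x + y) z = lie x z + lie y z.
Proof. by rewrite lieC lieDr opprD -!lieC. Qed.

Lemma lieZl (c : K) x y : lie (c *: x) y = c *: lie x y.
Proof. by rewrite lieC lieZr -scalerN -lieC. Qed.

Lemma lie_suml I (r : seq I) (F : I -> L) y :
  lie (\sum_(i <- r) F i) y = \sum_(i <- r) lie (F i) y.
Proof. by rewrite lieC lie_sumr -sumrN; apply: eq_bigr => i _; rewrite -lieC. Qed.

Lemma lie_leibniz x y z : lie x (lie y z) = lie (lie x y) z + lie y (lie x z).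
Proof.
have /eqP := lie_jacobi x y z.
rewrite (lieC z x) (lieC z (lie x y)) lieNr -addrA -opprD subr_eq0.
by move/eqP->; rewrite addrC.
Qed.

Lemma adE x y : ad x y = lie x y.
Proof. by rewrite lfunE. Qed.

Lemma mem_liev (U V : {vspace L}) x y :
  x \in U -> y \in V -> lie x y \in liev U V.
Proof.
move=> /coord_vbasis-> /coord_vbasis->; rewrite lie_suml; apply: memv_suml => i _.
rewrite lie_sumr; apply: memv_suml => j _; rewrite lieZl lieZr !memvZ //.
by apply/memv_span/allpairs_f; apply: mem_nth; rewrite size_tuple.
Qed.

Lemma lievS (U1 U2 V1 V2 : {vspace L}) :
  (U1 <= V1)%VS -> (U2 <= V2)%VS -> (liev U1 U2 <= liev V1 V2)%VS.
Proof.
move=> sU sV; apply/span_subvP => _ /allpairsP[[x y] [/= xU yU ->]].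
by apply: mem_liev; [apply: subvP sU _ _ | apply: subvP sV _ _]; apply: vbasis_mem.
Qed.

Let e := vbasis {: L}.
Let mxad x := passmx.mxof e e (ad x).

Let killingE x y : killing x y = \tr (mxad x *m mxad y).
Proof.
by rewrite /killing mxtrace_mulC -passmx.mxof_comp // vbasisP.
Qed.

Let mxadZD (c : K) x y : mxad (c *: x + y) = c *: mxad x + mxad y.
Proof.
rewrite /mxad -passmx.mxof_linear; congr passmx.mxof; apply/lfunP => z.
by rewrite !lfunE /= !lfunE /= !adE lieDl lieZl.
Qed.

(** Matrices act on row vectors, so composition reverses the order of the factors; hence the sign of
    the commutator. *)
Let mxad_lie x y : mxad (lie x y) = mxad y *m mxad x - mxad x *m mxad y.
Proof.
rewrite /mxad -!passmx.mxof_comp ?vbasisP // addrC -scaleN1r -passmx.mxof_linear.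
congr passmx.mxof.
apply/lfunP => z; rewrite add_lfunE scale_lfunE !comp_lfunE !adE scaleN1r.
by rewrite (lie_leibniz x) addrC addrK.
Qed.

Lemma killingC x y : killing x y = killing y x.
Proof. by rewrite !killingE mxtrace_mulC. Qed.

Fact killing_linear x : linear (killing x : L -> K^o).
Proof.
by move=> c y z; rewrite !killingE mxadZD mulmxDr -scalemxAr mxtraceD mxtraceZ.
Qed.
HB.instance Definition _ x := GRing.isLinear.Build K L K^o _ (killing x) (killing_linear x).

Lemma killingZr (c : K) x y : killing x (c *: y) = c * killing x y.
Proof. exact: linearZ. Qed.

Lemma killingNr x y : killing x (- y) = - killing x y.
Proof. exact: linearN. Qed.

Lemma killing0r x : killing x 0 = 0.
Proof. exact: linear0. Qed.

Lemma killing_sumr I (r : seq I) (F : I -> L) x :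
  killing x (\sum_(i <- r) F i) = \sum_(i <- r) killing x (F i).
Proof. exact: linear_sum. Qed.

Lemma killing_lie x y z : killing (lie x y) z = killing x (lie y z).
Proof.
rewrite !killingE !mxad_lie mulmxBl mulmxBr !linearB /= !mulmxA.
by rewrite -(mulmxA (mxad y)) mxtrace_mulC.
Qed.

End LieBracket.

(** * Root spaces and the elements [Hroot a] representing the roots *)

Section RootSpaces.
Variables (K : fieldType) (L : lieAlgType K) (h : {vspace L}).
Implicit Types (a b : cartan_dual h) (H x y : L).

Fact dual_eval_linear a : linear (dual_eval a : L -> K^o).
Proof. by move=> c x y; rewrite /dual_eval !linearP. Qed.
HB.instance Definition _ a :=
  GRing.isLinear.Build K L K^o _ (dual_eval a) (dual_eval_linear a).

Lemma dual_evalZ a c H : dual_eval a (c *: H) = c * dual_eval a H.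
Proof. exact: linearZ. Qed.

Lemma dual_evalN a H : dual_eval a (- H) = - dual_eval a H.
Proof. exact: linearN. Qed.

Lemma dual_evalD a H1 H2 : dual_eval a (H1 + H2) = dual_eval a H1 + dual_eval a H2.
Proof. exact: linearD. Qed.

Lemma dual_eval_sum a I (r : seq I) (F : I -> L) :
  dual_eval a (\sum_(i <- r) F i) = \sum_(i <- r) dual_eval a (F i).
Proof. exact: linear_sum. Qed.

Lemma dual_evalDl a b H : dual_eval (a + b) H = dual_eval a H + dual_eval b H.
Proof. by rewrite /dual_eval add_lfunE. Qed.

Lemma dual_evalNl a H : dual_eval (- a) H = - dual_eval a H.
Proof. by rewrite /dual_eval opp_lfunE. Qed.

Lemma dual_eval0l H : dual_eval (0 : cartan_dual h) H = 0.
Proof. by rewrite /dual_eval zero_lfunE. Qed.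

Lemma dual_evalZl c a H : dual_eval (c *: a) H = c * dual_eval a H.
Proof. by rewrite /dual_eval scale_lfunE. Qed.

Lemma dual_eval_suml I (r : seq I) (F : I -> cartan_dual h) H :
  dual_eval (\sum_(i <- r) F i) H = \sum_(i <- r) dual_eval (F i) H.
Proof. by rewrite /dual_eval sum_lfunE. Qed.

Lemma dual_eval_eq0 a : (forall H, H \in h -> dual_eval a H = 0) -> a = 0.
Proof.
move=> a0; apply/lfunP => u; rewrite zero_lfunE -(vsvalK u).
exact: a0 (subvsP u).
Qed.

Lemma root_space_lie a b x y :
  root_space a x -> root_space b y -> root_space (a + b) (lie x y).
Proof.
move=> ax bY H hH; rewrite lie_leibniz (ax H) // (bY H) // lieZl lieZr -scalerDl.
by rewrite dual_evalDl.
Qed.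

(** Invariance of the Killing form: the two summands are [killing (lie H x) y] and
    [killing x (lie H y)]. Root spaces of [a] and [b] are thus orthogonal unless [a + b = 0]. *)
Lemma root_space_killing a b x y H :
  root_space a x -> root_space b y -> H \in h ->
  dual_eval (a + b) H * killing x y = 0.
Proof.
move=> ax bY hH; rewrite dual_evalDl mulrDl.
have -> : dual_eval a H * killing x y = killing (lie H x) y.
  by rewrite ax // !(killingC _ y) killingZr.
have -> : dual_eval b H * killing x y = killing x (lie H y).
  by rewrite bY // killingZr.
by rewrite (lieC H x) killingC killingNr killingC killing_lie addNr.
Qed.

Hypothesis cartan_h : cartan_subalgebra h.

(** The bracket has weight 0, so it commutes with [h]; a Cartan subalgebra is its own normalizer. *)
Lemma root_space_lieN a x y :
  root_space a x -> root_space (- a) y -> lie x y \in h.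
Proof.
move=> ax ay; case: cartan_h => _ _; apply=> H hH.
have := root_space_lie ax ay hH.
by rewrite addrN dual_eval0l scale0r (lieC _ H) => ->; rewrite oppr0 mem0v.
Qed.

(** On a nonzero root vector [H1] and [H2] act by scalars, so their commutator acts by 0. This
    prepares the commutativity of [h], so far only known to be nilpotent. *)
Lemma dual_eval_lie a H1 H2 :
  lie_root a -> H1 \in h -> H2 \in h -> dual_eval a (lie H1 H2) = 0.
Proof.
case=> _ [x x0 ax] h1 h2; have [subh _ _] := cartan_h.
apply/eqP; have /eqP := ax _ (subh _ _ h1 h2).
have -> : lie (lie H1 H2) x = 0.
  apply/eqP; rewrite -(inj_eq (addIr (lie H2 (lie H1 x)))) -lie_leibniz add0r.
  by rewrite !(ax H1, ax H2) // !lieZr !(ax H1, ax H2) // !scalerA mulrC.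
by rewrite eq_sym scaler_eq0 (negPf x0) orbF.
Qed.

Hypothesis semisimple_L : semisimple L.
Variables (s : seq (cartan_dual h)) (X : cartan_dual h -> L).
Hypothesis sP : forall a, a \in s <-> lie_root a.
Hypothesis X_basis : basis_of fullv (vbasis h ++ [seq X a | a <- s]).
Hypothesis X_root : forall a, lie_root a -> root_space a (X a).

(** Meant for [W] a kernel or a preimage, to reduce linear conditions on [L] to [h] and the root
    vectors. *)
Lemma full_span (W : {vspace L}) :
  (h <= W)%VS -> (forall a, lie_root a -> X a \in W) -> forall x, x \in W.
Proof.
move=> hW XW x; have : x \in fullv by exact: memvf.
rewrite -(span_basis X_basis); apply: subvP x.
apply/span_subvP => y; rewrite mem_cat => /orP[/vbasis_mem|/mapP[a sa ->]].
  exact: subvP hW y.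
by apply: XW; apply/sP.
Qed.

Let z : {vspace L} := (h :&: \bigcap_(a <- s) lker (linfun (dual_eval a : L -> K^o)))%VS.

Let zP H : reflect (H \in h /\ forall a, lie_root a -> dual_eval a H = 0) (H \in z).
Proof.
rewrite memv_cap.
have -> : (H \in (\bigcap_(a <- s) lker (linfun (dual_eval a : L -> K^o)))%VS)
        = all (fun a => dual_eval a H == 0) s.
  elim: s => [|a r IH] /=; first by rewrite big_nil memvf.
  by rewrite big_cons memv_cap IH memv_ker lfunE.
apply: (iffP andP) => -[hH Hz]; split=> //.
  by move=> a /sP sa; apply/eqP; have /allP := Hz; apply.
by apply/allP => a /sP /Hz ->.
Qed.

Lemma cartan_dual_separated H :
  H \in h -> (forall a, lie_root a -> dual_eval a H = 0) -> H = 0.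
Proof.
move=> hH H0; suff z0 : z = 0%VS.
  by apply/eqP; rewrite -memv0 -z0; apply/zP.
have [subh [k hk] _] := cartan_h.
(* The common kernel z of the roots is an ideal, solvable as a part of h. *)
have idz : ideal z.
  move=> x y zy; rewrite lieC memvN -adE memv_preim.
  have /zP[hy y0] := zy; apply: full_span => [|a ra].
    apply/subvP => u hu; rewrite -memv_preim adE.
    by apply/zP; split=> [|a ra]; [apply: subh | apply: dual_eval_lie].
  by rewrite -memv_preim adE X_root // y0 // scale0r mem0v.
apply: semisimple_L => //; exists k; apply/eqP; rewrite -subv0 -hk.
have zh : (z <= h)%VS by exact: capvSl.
have Dz j : (derived_series z j <= z)%VS.
  elim: j => //= j IH; apply/span_subvP => _ /allpairsP[[x y] [/= xU yU ->]].
  by apply: idz; apply: (subvP IH); apply: vbasis_mem.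
(* The derived series of [z] stays termwise below the lower central series of [h]: one factor of the
   bracket lies in [z], hence in [h], the other is bounded by induction. *)
elim: k {hk} => //= k IH; apply: lievS => //.
by apply: subv_trans zh.
Qed.

Lemma lie_cartan H1 H2 : H1 \in h -> H2 \in h -> lie H1 H2 = 0.
Proof.
move=> h1 h2; have [subh _ _] := cartan_h.
by apply: cartan_dual_separated => [|a ra]; [apply: subh | apply: dual_eval_lie].
Qed.

Hypothesis X_killing : forall a, lie_root a -> killing (X a) (X (- a)) = 1.

Lemma root_vector_neq0 a : lie_root a -> X a != 0.
Proof.
move=> ra; apply/eqP => Xa0; have := X_killing ra.
by rewrite Xa0 killingC killing0r => /esym/eqP; rewrite oner_eq0.
Qed.

(** Otherwise [a + b] is nonzero for [b = 0] and for every root [b], so [X a] is Killing-orthogonal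
    to [h] and to all root vectors, hence to [L]. This contradicts [killing (X a) (X (- a)) = 1]. *)
Lemma lie_rootN a : lie_root a -> lie_root (- a).
Proof.
move=> ra; apply: contrapT => nra.
have orth b : lie_root b \/ b = 0 -> exists2 H, H \in h & dual_eval (a + b) H != 0.
  move=> rb; apply: contrapT => nH.
  have /eqP : a + b = 0.
    apply: dual_eval_eq0 => H hH; apply/eqP/negPn/negP => abH.
    by apply: nH; exists H.
  rewrite addrC addr_eq0 => /eqP ba; case: rb => [rb|b0].
    by apply: nra; rewrite -ba.
  by case: ra => /eqP[]; rewrite -[a]opprK -ba b0 oppr0.
have killing0 b y : lie_root b \/ b = 0 -> root_space b y -> killing (X a) y = 0.
  move=> rb ry; have [H hH abH] := orth b rb.
  have /eqP := root_space_killing (X_root ra) ry hH.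
  by rewrite mulf_eq0 (negPf abH) => /eqP.
suff : X (- a) \in lker (linfun (killing (X a) : L -> K^o)).
  rewrite memv_ker lfunE /= X_killing // => /eqP/eqP.
  by rewrite oner_eq0.
apply: full_span => [|b rb].
  apply/subvP => H hH; rewrite memv_ker lfunE; apply/eqP.
  apply: (killing0 0); first by right.
  by move=> H' hH'; rewrite lie_cartan // dual_eval0l scale0r.
rewrite memv_ker lfunE; apply/eqP; apply: (killing0 b); first by left.
exact: X_root.
Qed.

(** Invariance and the normalization of [X] show that the bracket represents [a]. By symmetry of the
    Killing form every root takes the same value on any two representatives, so they coincide by
    [cartan_dual_separated]. *)
Lemma HrootE a : lie_root a -> Hroot a = lie (X a) (X (- a)).
Proof.
move=> ra; have rNa := lie_rootN ra.
have lieh b : lie_root b -> lie (X b) (X (- b)) \in h.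
  by move=> rb; apply: (@root_space_lieN b); apply: X_root => //; apply: lie_rootN.
have lieE b H : lie_root b -> H \in h ->
    dual_eval b H = killing H (lie (X b) (X (- b))).
  move=> rb hH; rewrite -killing_lie (X_root rb hH).
  by rewrite killingC killingZr killingC X_killing // mulr1.
apply: xget_unique; first by split=> [|H hH]; [apply: lieh | apply: lieE].
move=> H [hH Ha]; apply/eqP; rewrite -subr_eq0; apply/eqP.
apply: cartan_dual_separated => [|b rb]; first by rewrite rpredB // lieh.
rewrite dual_evalD dual_evalN !lieE //; last exact: lieh.
rewrite !(killingC _ (lie (X b) _)).
by rewrite -Ha ?lieh // lieE ?lieh // subrr.
Qed.

Lemma Hroot_cartan a : lie_root a -> Hroot a \in h.
Proof.
move=> ra; rewrite HrootE //; apply: (@root_space_lieN a); apply: X_root => //.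
exact: lie_rootN.
Qed.

Lemma HrootP a H : lie_root a -> H \in h -> dual_eval a H = killing H (Hroot a).
Proof.
move=> ra hH; rewrite HrootE // -killing_lie (X_root ra hH).
by rewrite killingC killingZr killingC X_killing // mulr1.
Qed.

Lemma dual_eval_HrootC a b :
  lie_root a -> lie_root b -> dual_eval a (Hroot b) = dual_eval b (Hroot a).
Proof. by move=> ra rb; rewrite (HrootP ra) ?(HrootP rb) ?Hroot_cartan // killingC. Qed.

Lemma HrootN a : lie_root a -> Hroot (- a) = - Hroot a.
Proof.
move=> ra; rewrite (HrootE (lie_rootN ra)) (HrootE ra).
by rewrite opprK lieC.
Qed.

(** The form is nondegenerate on the span of the roots: [f] is represented by a combination [Hf] of
    the [Hroot], and a root [b] takes on [Hf] the value [dual_eval f (Hroot b)]. *)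
Lemma root_span_eq0 f : f \in <<s>>%VS ->
  (forall b, lie_root b -> dual_eval f (Hroot b) = 0) -> f = 0.
Proof.
rewrite -[s]/(tval (in_tuple s)) => /coord_span fE f0.
have rs (i : 'I_(size s)) : lie_root s`_i by apply/sP/mem_nth.
pose Hf := \sum_i coord (in_tuple s) i f *: Hroot (in_tuple s)`_i.
have hHf : Hf \in h by apply: memv_suml => i _; apply/memvZ/Hroot_cartan/rs.
have fP H : H \in h -> dual_eval f H = killing H Hf.
  move=> hH; rewrite {1}fE dual_eval_suml killing_sumr; apply: eq_bigr => i _.
  by rewrite dual_evalZl killingZr HrootP.
have Hf0 : Hf = 0.
  apply: cartan_dual_separated => // b rb.
  by rewrite HrootP // killingC -fP ?Hroot_cartan // f0.
by apply: dual_eval_eq0 => H hH; rewrite fP // Hf0 killing0r.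
Qed.

End RootSpaces.

(** * Closure properties of real spans *)

Section RealSpan.
Variables (R : realType) (L : lieAlgType R[i]).
Implicit Types (A B : set L) (v w : L).

Lemma real_span_mem A v : A v -> real_span A v.
Proof.
move=> Av; exists 1%N, (fun=> 1), (fun=> v); split=> //.
by rewrite big_ord1 scale1r.
Qed.

Lemma real_span0 A : real_span A 0.
Proof. by exists 0%N, (fun=> 0), (fun=> 0); split=> [[]|]; rewrite ?big_ord0. Qed.

Lemma real_spanZ A (c : R) v : real_span A v -> real_span A (c%:C *: v).
Proof.
move=> [m [d [w [Aw ->]]]]; exists m, (fun i => c * d i), w; split=> //.
by rewrite scaler_sumr; apply: eq_bigr => i _; rewrite scalerA rmorphM.
Qed.

Lemma real_spanN A v : real_span A v -> real_span A (- v).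
Proof. by move/(@real_spanZ _ (- 1)); rewrite rmorphN1 scaleN1r. Qed.

Lemma real_spanD A v w : real_span A v -> real_span A w -> real_span A (v + w).
Proof.
move=> [m [c [x [Ax ->]]]] [k [d [y [Ay ->]]]].
exists (m + k)%N, (fun i : 'I_(m + k) =>
    match fintype.split i with inl j => c j | inr j => d j end),
  (fun i : 'I_(m + k) => match fintype.split i with inl j => x j | inr j => y j end); split.
  by move=> i; case: (fintype.split i).
rewrite big_split_ord; congr (_ + _); apply: eq_bigr => i _.
  by have /= -> := @fintype.unsplitK _ _ (inl i).
by have /= -> := @fintype.unsplitK _ _ (inr i).
Qed.

Lemma real_span_min A (P : L -> Prop) :
  P 0 -> (forall (c : R) v w, A v -> P w -> P (c%:C *: v + w)) ->
  forall v, real_span A v -> P v.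
Proof.
move=> P0 PD _ [m [c [w [Aw ->]]]].
by apply: big_rec => // i x _; apply: PD.
Qed.
End RealSpan.

(** * Real root values from a Weyl basis, and separation of [R_M] by [t_Theta] *)

Section WeylBasis.
Variables (R : realType) (L : lieAlgType R[i]) (h : {vspace L}).
Variables (X : cartan_dual h -> L) (n : cartan_dual h -> cartan_dual h -> R).
Implicit Types (a b : cartan_dual h) (H : L).

Hypothesis semisimple_L : semisimple L.
Hypothesis cartan_h : cartan_subalgebra h.
Hypothesis weylX : weyl_basis X n.

Let rootN a : lie_root a -> lie_root (- a).
Proof.
have [s [_ sP Xs]] := weyl_basis_of weylX.
exact: (lie_rootN cartan_h semisimple_L sP Xs
  (weyl_root_space weylX) (weyl_killing weylX)).
Qed.

Let XrootE a : lie_root a -> Hroot a = lie (X a) (X (- a)).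
Proof.
have [s [_ sP Xs]] := weyl_basis_of weylX.
exact: (HrootE cartan_h semisimple_L sP Xs
  (weyl_root_space weylX) (weyl_killing weylX)).
Qed.

Let Hroot_h a : lie_root a -> Hroot a \in h.
Proof.
have [s [_ sP Xs]] := weyl_basis_of weylX.
exact: (Hroot_cartan cartan_h semisimple_L sP Xs
  (weyl_root_space weylX) (weyl_killing weylX)).
Qed.

Let HrootC a b :
  lie_root a -> lie_root b -> dual_eval a (Hroot b) = dual_eval b (Hroot a).
Proof.
have [s [_ sP Xs]] := weyl_basis_of weylX.
exact: (dual_eval_HrootC cartan_h semisimple_L sP Xs
  (weyl_root_space weylX) (weyl_killing weylX)).
Qed.

Let XrootN a : lie_root a -> Hroot (- a) = - Hroot a.
Proof.
have [s [_ sP Xs]] := weyl_basis_of weylX.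
exact: (HrootN cartan_h semisimple_L sP Xs
  (weyl_root_space weylX) (weyl_killing weylX)).
Qed.

Let lie_cartan_h H1 H2 : H1 \in h -> H2 \in h -> lie H1 H2 = 0.
Proof.
have [s [_ sP Xs]] := weyl_basis_of weylX.
exact: (lie_cartan cartan_h semisimple_L sP Xs (weyl_root_space weylX)).
Qed.

Let X_neq0 a : lie_root a -> X a != 0.
Proof. exact: (root_vector_neq0 (weyl_killing weylX)). Qed.

Lemma weyl_lie_cancel a b : lie_root a -> lie_root b -> b + a != 0 ->
  lie (X (- b)) (lie (X b) (X a)) = (n b a * n (- b) (b + a))%:C *: X a.
Proof.
move=> ra rb ba0; rewrite (weyl_lie weylX) // lieZr.
(* A zero coefficient covers the case where [b + a] is not a root and [X (b + a)] is arbitrary. *)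
have [->|nba] := eqVneq (n b a) 0; first by rewrite mul0r !scale0r.
have rba : lie_root (b + a) by apply/(weyl_neq0 weylX).
rewrite (weyl_lie weylX) ?addKr //; last by case: ra.
  by rewrite scalerA rmorphM.
exact: rootN.
Qed.

(** [Hroot b] is the bracket of [X b] and [X (- b)]; the Jacobi identity on [X a] gives two double
    brackets, each a real multiple of [X a]. Excluding [a = b] and [a = - b] keeps all brackets
    within the Weyl relations. *)
Lemma dual_eval_Hroot_weyl a b : lie_root a -> lie_root b -> a != b -> a != - b ->
  dual_eval a (Hroot b) =
    (n (- b) a * n b (- b + a) - n b a * n (- b) (b + a))%:C.
Proof.
move=> ra rb ab aNb.
have ba0 : b + a != 0 by rewrite addrC addr_eq0.
have Nba0 : - b + a != 0 by have := ab; rewrite -(inj_eq (addrI (- b))) addNr.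
have /eqP := weyl_root_space weylX ra (Hroot_h rb).
have /eqP := lie_leibniz (X b) (X (- b)) (X a).
have := weyl_lie_cancel ra (rootN rb) Nba0; rewrite opprK => ->.
rewrite weyl_lie_cancel // -subr_eq -XrootE // => /eqP <-.
rewrite -scalerBl -subr_eq0 -scalerBl scaler_eq0 (negPf (X_neq0 ra)) orbF.
by rewrite subr_eq0 => /eqP <-; rewrite rmorphB.
Qed.

Lemma dual_eval_Hroot_real a b : lie_root a -> lie_root b -> a != b -> a != - b ->
  dual_eval a (Hroot b) \is Num.real.
Proof.
by move=> ra rb ab aNb; rewrite dual_eval_Hroot_weyl //; apply/complex_realP; eexists.
Qed.

(* If a + b or a - b is a root, then b(H_b) is, up to sign, a difference of two
   real values, unless a = 2b or a = -2b, in which case it is half of one. *)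
Lemma dual_eval_Hroot_eq0 a b :
  lie_root a -> lie_root b -> dual_eval b (Hroot b) \isn't Num.real ->
  a != b -> a != - b -> dual_eval a (Hroot b) = 0.
Proof.
move=> ra rb breal ab aNb.
(* Needed at [c = b] and at [c = - b]: each product in [dual_eval_Hroot_weyl] contains one of
   [n b a] and [n (- b) a]. *)
have key c : lie_root c -> dual_eval c (Hroot c) \isn't Num.real ->
    a != c -> a != - c -> n c a = 0.
  move=> rc ncreal ac aNc; apply: contraNeq ncreal.
  move=> /(weyl_neq0 weylX rc ra) rca.
  have areal := dual_eval_Hroot_real ra rc ac aNc.
  have [cNc|cNc] := eqVneq (c + a) (- c).
    have aE : a = - (c + c) by rewrite opprD -{1}cNc addrAC subrr add0r.
    move: areal; rewrite aE dual_evalNl dual_evalDl rpredN => ccreal.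
    have two0 : 2 != 0 :> R[i] by rewrite pnatr_eq0.
    rewrite -[X in X \is _](mulfK two0).
    by rewrite realM ?realV ?realn // mulr_natr mulr2n.
  have cac : c + a != c.
    by rewrite -subr_eq0 addrAC subrr add0r; case: ra.
  have := dual_eval_Hroot_real rca rc cac cNc.
  rewrite dual_evalDl => careal.
  by rewrite -[X in X \is _](addrK (dual_eval a (Hroot c))) rpredB.
rewrite dual_eval_Hroot_weyl // (key b) //.
have Nbreal : dual_eval (- b) (Hroot (- b)) \isn't Num.real.
  by rewrite XrootN // dual_evalNl dual_evalN opprK.
have aNNb : a != - - b by rewrite opprK.
by rewrite (key _ (rootN rb) Nbreal aNb aNNb) !mul0r subr0.
Qed.

(** Elements of [t_Theta] are ['i] times real combinations of the [Hroot], so complex independence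
    of [a] from [Theta] has to be turned into a solvable linear system over the reals. *)
Lemma t_Theta_separates (Theta : seq (cartan_dual h)) a :
  R_M Theta a -> exists2 H, t_Theta Theta H & dual_eval a H != 0.
Proof.
move=> [ra aTheta].
have aspan : a \notin <<Theta>>%VS by apply/negP => aT; apply: aTheta.
have [s [_ sP Xs]] := weyl_basis_of weylX.
have ihR b : lie_root b -> h_R h (Hroot b) by move=> rb; apply: real_span_mem; exists b.
have [areal|anreal] := boolP (dual_eval a (Hroot a) \is Num.real); last first.
  (* A root in the span of [Theta] is neither [a] nor [- a], so it vanishes on [Hroot a]. *)
  exists ('i *: Hroot a).
    split; first by exists (Hroot a) => //; apply: ihR.
    move=> g [rg gspan]; rewrite dual_evalZ dual_eval_Hroot_eq0 ?mulr0 //.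
      by apply: contraNneq aspan => <-.
    by apply: contraNneq aspan => ga; rewrite -memvN -ga.
  rewrite dual_evalZ mulf_neq0 ?neq0Ci //.
  by apply: contraNneq anreal => ->; exact: real0.
(* Roots in [s'] have real values on each other's [Hroot] ([s'real]) and vanish on that of any other
   root ([s'0]), so only [s'] enters the system. *)
pose s' := [seq d <- s | dual_eval d (Hroot d) \is Num.real].
have s'P d : d \in s' -> lie_root d /\ dual_eval d (Hroot d) \is Num.real.
  by rewrite mem_filter => /andP[dreal /sP].
have s'real g d : g \in s' -> d \in s' -> dual_eval g (Hroot d) \is Num.real.
  move=> /s'P[rg greal] /s'P[rd dreal].
  have [->//|gd] := eqVneq g d.
  have [->|gNd] := eqVneq g (- d); first by rewrite dual_evalNl rpredN.
  exact (dual_eval_Hroot_real rg rd gd gNd).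
have s'0 g d : g \in s' -> lie_root d -> d \notin s' -> dual_eval g (Hroot d) = 0.
  move=> gs' rd ds'; have [rg greal] := s'P _ gs'.
  have dnreal : dual_eval d (Hroot d) \isn't Num.real.
    by move: ds'; rewrite mem_filter (introT idP (iffRL (sP d) rd)) andbT.
  apply: dual_eval_Hroot_eq0 => //; first by apply: contraNneq ds' => <-.
  apply: contraNneq dnreal => gd; rewrite -[d]opprK -gd.
  by rewrite XrootN // dual_evalNl dual_evalN opprK.
pose T := [seq g <- s' | g \in <<Theta>>%VS].
have Ts' (i : 'I_(size T)) : T`_i \in s' /\ T`_i \in <<Theta>>%VS.
  by apply/andP; rewrite andbC -mem_filter mem_nth.
have s'_nth (j : 'I_(size s')) : s'`_j \in s' by rewrite mem_nth.
have as' : a \in s' by rewrite mem_filter areal; apply/sP.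
pose A := \matrix_(i < size T, j < size s') complex.Re (dual_eval T`_i (Hroot s'`_j)).
pose v := \row_(j < size s') complex.Re (dual_eval a (Hroot s'`_j)).
have AE (i : 'I_(size T)) (j : 'I_(size s')) : dual_eval T`_i (Hroot s'`_j) = (A i j)%:C.
  by rewrite mxE RRe_real // s'real //; have [] := Ts' i.
have vE (j : 'I_(size s')) : dual_eval a (Hroot s'`_j) = (v 0 j)%:C.
  by rewrite mxE RRe_real // s'real.
(* If v is not in the row space of A, a column of the cokernel of A on which v
   does not vanish gives the real coefficients of H. *)
have [/submxP[D vDA]|] := boolP (v <= A)%MS.
  case/negP: aspan.
  (* If [v = D *m A], then [f] vanishes on every [Hroot b]: by this equation for [b] in [s'], by
     [s'0] otherwise. So [f = 0], which puts [a] in the span of [Theta]. *)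
  pose f := a - \sum_(i < size T) (D 0 i)%:C *: T`_i.
  suff /eqP : f = 0.
    rewrite subr_eq0 => /eqP ->; apply: memv_suml => i _.
    by apply: memvZ; have [] := Ts' i.
  apply: (root_span_eq0 cartan_h semisimple_L sP Xs
      (weyl_root_space weylX) (weyl_killing weylX)).
    apply: rpredB; first exact/memv_span/sP.
    apply: memv_suml => i _; apply/memvZ/memv_span/sP.
    by have [/s'P[]] := Ts' i.
  move=> b rb; rewrite dual_evalDl dual_evalNl dual_eval_suml.
  have [bs'|bs'] := boolP (b \in s'); last first.
    rewrite s'0 // big1 ?subr0 // => i _.
    by rewrite dual_evalZl s'0 ?mulr0 //; have [] := Ts' i.
  have [j ->] : exists j : 'I_(size s'), b = s'`_j.
    by have /(nthP 0)[j js' <-] := bs'; exists (Ordinal js').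
  rewrite vE vDA mxE rmorph_sum /=; apply/eqP; rewrite subr_eq0; apply/eqP.
  by apply: eq_bigr => i _; rewrite dual_evalZl AE rmorphM.
rewrite submxE => /matrix0Pn[i0 [j]]; rewrite {i0}ord1 => vAj.
pose H0 := \sum_(k < size s') (cokermx A k j)%:C *: Hroot s'`_k.
exists ('i *: H0).
  split.
    exists H0 => //; exists (size s'), (fun k => cokermx A k j), (fun k => Hroot s'`_k).
    by split=> // k; exists s'`_k => //; have [] := s'P _ (s'_nth k).
  move=> g [rg gspan]; rewrite dual_evalZ dual_eval_sum.
  have [gs'|gs'] := boolP (g \in s'); last first.
    rewrite big1 ?mulr0 // => k _; have [rk _] := s'P _ (s'_nth k).
    by rewrite dual_evalZ HrootC // s'0 ?mulr0.
  have gT : g \in T by rewrite mem_filter gspan.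
  have [i gE] : exists i : 'I_(size T), g = T`_i.
    by have /(nthP 0)[i iT <-] := gT; exists (Ordinal iT).
  have /matrixP/(_ i j) := mulmx_coker A; rewrite !mxE => A0.
  suff -> : \sum_(k < size s') dual_eval g ((cokermx A k j)%:C *: Hroot s'`_k) =
            (\sum_k A i k * cokermx A k j)%:C by rewrite A0 mulr0.
  rewrite rmorph_sum; apply: eq_bigr => k _.
  by rewrite dual_evalZ gE AE mulrC rmorphM.
rewrite dual_evalZ mulf_neq0 ?neq0Ci // dual_eval_sum.
suff -> : \sum_(k < size s') dual_eval a ((cokermx A k j)%:C *: Hroot s'`_k) =
          ((v *m cokermx A) 0 j)%:C by rewrite fmorph_eq0.
rewrite mxE rmorph_sum; apply: eq_bigr => k _.
by rewrite dual_evalZ vE mulrC rmorphM.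
Qed.

(** * Generators of [k_Theta] and [m_Theta] *)

Variables (Sigma Theta : seq (cartan_dual h)).
Hypothesis simple_Sigma : simple_system Sigma.

Local Notation Y a := (X a - X (- a)).
Local Notation Z a := ('i *: (X a + X (- a))).
Local Notation k := (k_Theta Sigma Theta X).
Local Notation m := (m_Theta Sigma Theta X).

Lemma k_Theta_cartan a : lie_root a -> k ('i *: Hroot a).
Proof.
move=> ra; apply: real_span_mem; left; exists (Hroot a) => //.
by apply: real_span_mem; exists a.
Qed.

(** Passing from [a] to [- a] negates [Y a] and fixes [Z a], so negative roots add nothing new. This
    serves differences [a - b] of unknown sign. *)
Lemma k_Theta_root a : R_Theta Theta a -> k (Y a) /\ k (Z a).
Proof.
have pos b : R_Theta_pos Sigma Theta b -> k (Y b) /\ k (Z b).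
  by move=> pb; split; apply: real_span_mem; right; exists b => //;
     apply: real_span_mem; [left | right].
move=> [ra aT]; have [_ _ /(_ a ra)[pa|pNa]] := simple_Sigma.
  by apply: pos.
have [|kY kZ] := pos (- a); first by split=> //; split; [exact: rootN | rewrite memvN].
rewrite opprK in kY kZ; split; last by rewrite addrC.
by rewrite -opprB; apply: real_spanN.
Qed.

Lemma m_Theta_ind (P : L -> Prop) :
  P 0 -> (forall (c : R) v w, P v -> P w -> P (c%:C *: v + w)) ->
  (forall a, R_M_pos Sigma Theta a -> P (Y a) /\ P (Z a)) ->
  forall v, m v -> P v.
Proof.
move=> P0 PD PYZ; apply: real_span_min => // c v w [a pa uv] Pw.
apply: (PD) => //; move: v uv; apply: real_span_min => // d v w' vYZ Pw'.
by apply: PD => //; have [PY PZ] := PYZ _ pa; case: vYZ => ->.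
Qed.

(** * The grading by an element of [t_Theta] on which all of [R_M_pos] takes one nonzero value *)

Variables (H : L) (c : R[i]).
Hypothesis tH : t_Theta Theta H.
Hypothesis c_neq0 : c != 0.
Hypothesis Hc : forall a, R_M_pos Sigma Theta a -> dual_eval a H = c.

Let tH_h : H \in h.
Proof.
have [[H0 H0R <-] _] := tH; apply: memvZ; move: H0 H0R.
apply: real_span_min => [|d v w [a ra <-] hw]; first exact: mem0v.
by rewrite memvD // memvZ // Hroot_h.
Qed.

Lemma grading_values a : lie_root a ->
  [\/ R_Theta Theta a, dual_eval a H = c | dual_eval a H = - c].
Proof.
move=> ra; have [aT|aT] := pselect (R_Theta Theta a); first by constructor 1.
have [_ _ /(_ a ra)[pa|pNa]] := simple_Sigma; first by constructor 2; apply: Hc.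
constructor 3; rewrite -[a]opprK dual_evalNl Hc //; split=> //.
split; first exact: rootN.
by case=> _; rewrite memvN => aspan; apply: aT.
Qed.

Lemma R_M_pos_root a : R_M_pos Sigma Theta a -> lie_root a.
Proof. by case=> -[]. Qed.

Lemma R_M_pos_sum a b :
  R_M_pos Sigma Theta a -> R_M_pos Sigma Theta b -> ~ lie_root (a + b).
Proof.
have c2 : c + c != 0 by rewrite -mulr2n -mulr_natr mulf_neq0 // pnatr_eq0.
move=> pa pb rab; have Hab : dual_eval (a + b) H = c + c by rewrite dual_evalDl !Hc.
have [abT|cc|cc] := grading_values rab.
- by have [_ /(_ _ abT)/eqP] := tH; rewrite Hab (negPf c2).
- by move/eqP: cc; rewrite Hab -subr_eq0 addrK (negPf c_neq0).
- move/eqP: cc; rewrite Hab -subr_eq0 opprK -mulr2n -mulrSr -mulr_natr mulf_eq0.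
  by rewrite (negPf c_neq0) pnatr_eq0.
Qed.

Lemma R_M_pos_sub a b : R_M_pos Sigma Theta a -> R_M_pos Sigma Theta b ->
  lie_root (a - b) -> R_Theta Theta (a - b).
Proof.
move=> pa pb rab.
have Hab : dual_eval (a - b) H = 0 by rewrite dual_evalDl dual_evalNl !Hc // subrr.
have [//|/esym/eqP|/esym/eqP] := grading_values rab.
- by rewrite Hab (negPf c_neq0).
- by rewrite Hab oppr_eq0 (negPf c_neq0).
Qed.

Lemma R_M_pos_lie0 a b : R_M_pos Sigma Theta a -> R_M_pos Sigma Theta b ->
  lie (X a) (X b) = 0 /\ lie (X (- a)) (X (- b)) = 0.
Proof.
move=> pa pb; have [ra rb] := (R_M_pos_root pa, R_M_pos_root pb).
have nab : ~ lie_root (a + b) by exact: R_M_pos_sum.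
have ab0 : a + b != 0.
  apply/eqP => ab0; have := dual_evalDl a b H.
  rewrite ab0 dual_eval0l !Hc // => /esym/eqP.
  by rewrite -mulr2n -mulr_natr mulf_eq0 (negPf c_neq0) pnatr_eq0.
have n0 : n a b = 0.
  by apply/eqP/negPn/negP => /(weyl_neq0 weylX ra rb).
have nN0 : n (- a) (- b) = 0.
  by apply: oppr_inj; rewrite oppr0 -(weyl_opp weylX).
split; rewrite (weyl_lie weylX) ?n0 ?nN0 ?scale0r //; try exact: rootN.
by rewrite -opprD oppr_eq0.
Qed.

(** These are the combinations occurring in brackets of [Y] and [Z]. For [a = b] they are 0 and
    twice ['i *: Hroot a]; otherwise [weyl_opp] makes them the multiples of [Y (a - b)] and
    [Z (a - b)] by [n a (- b)]. *)
Lemma R_M_pos_lieN a b : R_M_pos Sigma Theta a -> R_M_pos Sigma Theta b ->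
  k (lie (X a) (X (- b)) + lie (X (- a)) (X b)) /\
  k ('i *: (lie (X a) (X (- b)) - lie (X (- a)) (X b))).
Proof.
move=> pa pb; have [ra rb] := (R_M_pos_root pa, R_M_pos_root pb).
have [<-|ab] := eqVneq a b.
  rewrite (lieC (X (- a))) subrr opprK -XrootE // -mulr2n -scaler_nat scalerA mulrC -scalerA.
  split; first exact: real_span0.
  rewrite -(rmorph_nat (real_complex R) 2).
  exact/real_spanZ/k_Theta_cartan.
have -> : lie (X a) (X (- b)) = (n a (- b))%:C *: X (a - b).
  by rewrite (weyl_lie weylX) ?subr_eq0 //; apply: rootN.
have -> : lie (X (- a)) (X b) = - ((n a (- b))%:C *: X (- (a - b))).
  rewrite (weyl_lie weylX) ?opprB 1?addrC ?subr_eq0 1?eq_sym //; last exact: rootN.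
  by rewrite [n a _](weyl_opp weylX) ?opprK ?rmorphN ?scaleNr ?opprK //; apply: rootN.
rewrite opprK -scalerBr -scalerDr scalerA mulrC -scalerA.
have [->|/(weyl_neq0 weylX ra (rootN rb)) rab] := eqVneq (n a (- b)) 0.
  by rewrite !scale0r; split; apply: real_span0.
have [kY kZ] := k_Theta_root (R_M_pos_sub pa pb rab).
by split; apply: real_spanZ.
Qed.

Lemma lie_m_Theta x y : m x -> m y -> k (lie x y).
Proof.
move=> mx my; move: x mx; apply: m_Theta_ind => [|d v w kv kw|a pa].
- by rewrite lie0l; apply: real_span0.
- by rewrite lieDl lieZl; apply/real_spanD/kw/real_spanZ.
suff : k (lie (Y a) y) /\ k (lie (Z a) y) by [].
move: y my; apply: m_Theta_ind => [|d v w [kv kv'] [kw kw']|b pb].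
- by rewrite !lie0r; split; apply: real_span0.
- by rewrite !lieDr !lieZr; split; apply: real_spanD => //; apply: real_spanZ.
have [ab0 Nab0] := R_M_pos_lie0 pa pb.
(* The instance with [a] and [b] exchanged handles [lie (Z a) (Y b)] through antisymmetry. *)
have [kD kB] := R_M_pos_lieN pa pb; have [_ kB'] := R_M_pos_lieN pb pa.
have YY : lie (Y a) (Y b) = - (lie (X a) (X (- b)) + lie (X (- a)) (X b)).
  by rewrite lieDl !lieDr !lieNl !lieNr ab0 Nab0 opprK add0r addr0 opprD.
have YZ a' b' : R_M_pos Sigma Theta a' -> R_M_pos Sigma Theta b' ->
    lie (Y a') (Z b') = 'i *: (lie (X a') (X (- b')) - lie (X (- a')) (X b')).
  move=> pa' pb'; have [ab0' Nab0'] := R_M_pos_lie0 pa' pb'.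
  by rewrite lieZr lieDl !lieDr !lieNl ab0' Nab0' add0r oppr0 addr0.
have ZZ : lie (Z a) (Z b) = - (lie (X a) (X (- b)) + lie (X (- a)) (X b)).
  rewrite lieZl lieZr scalerA -expr2 sqrCi scaleN1r lieDl !lieDr ab0 Nab0.
  by rewrite add0r addr0.
split; [split; first rewrite YY | split]; rewrite ?YY ?YZ ?ZZ ?(lieC (Z a)) ?YZ //;
  by apply: real_spanN.
Qed.

Lemma lie_t_k_Theta v : k v -> lie H v = 0.
Proof.
move: v; apply: real_span_min => [|d v w uv Hw]; first exact: lie0r.
rewrite lieDr lieZr Hw addr0; suff -> : lie H v = 0 by rewrite scaler0.
case: uv => [[H0 H0R <-]|[a [[ra aT] pa] uv]].
  rewrite lieZr lie_cartan_h ?scaler0 //; move: H0 H0R.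
  apply: real_span_min => [|e x y [a ra <-] hy]; first exact: mem0v.
  by rewrite memvD // memvZ // Hroot_h.
have Ha0 : dual_eval a H = 0 by have [_] := tH; apply.
have Xa : lie H (X a) = 0 by rewrite (weyl_root_space weylX) // Ha0 scale0r.
have XNa : lie H (X (- a)) = 0.
  by rewrite (weyl_root_space weylX (rootN ra)) // dual_evalNl Ha0 oppr0 scale0r.
move: v uv; apply: real_span_min => [|e x y xYZ Hy]; first exact: lie0r.
rewrite lieDr lieZr Hy addr0; case: xYZ => ->.
  by rewrite lieDr lieNr Xa XNa subrr scaler0.
by rewrite lieZr lieDr Xa XNa addr0 !scaler0.
Qed.

(** [X a] and [X (- a)] have the opposite eigenvalues [c] and [- c], so [Y a] and [Z a] are
    eigenvectors only of the square of [ad H]. *)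
Lemma lie_t_m_Theta v : m v -> lie H (lie H v) = (c * c) *: v.
Proof.
move: v; apply: m_Theta_ind => [|d v w Hv Hw|a pa].
- by rewrite !lie0r scaler0.
- by rewrite !lieDr !lieZr Hv Hw scalerDr !scalerA mulrC.
have ra := R_M_pos_root pa.
have Xa : lie H (X a) = c *: X a by rewrite (weyl_root_space weylX) // Hc.
have XNa : lie H (X (- a)) = - (c *: X (- a)).
  by rewrite (weyl_root_space weylX (rootN ra)) // dual_evalNl Hc // scaleNr.
split.
  by rewrite !(lieDr, lieNr, Xa, XNa, lieZr, opprK) scalerBr -!scalerA scalerN.
rewrite !(lieDr, lieNr, Xa, XNa, lieZr) !scalerN opprK -!scalerDr !scalerA.
by rewrite [c * c * _]mulrC mulrA.
Qed.

(** The bracket lies in [k], so 0 is a projection of it. Any other one lies in both [k] and [m],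
    where the square of [ad H] is both 0 and [c * c]; so the choice in [proj_m] returns 0. *)
Lemma lie_m_eq0 x y : m x -> m y -> lie_m Sigma Theta X x y = 0.
Proof.
move=> mx my; have kxy := lie_m_Theta mx my.
apply: xget_unique; first by split; [apply: real_span0 | rewrite subr0].
move=> w [mw kw]; have kw' : k w.
  by rewrite -[w](subKr (lie x y)); apply: real_spanD => //; apply: real_spanN.
have /eqP := lie_t_m_Theta mw.
rewrite (lie_t_k_Theta kw') lie0r eq_sym scaler_eq0 mulf_eq0 (negPf c_neq0).
by move/eqP.
Qed.

End WeylBasis.

Theorem corollary5p3 (R : realType) (L : lieAlgType R[i]) (h : {vspace L})
    (Sigma Theta : seq (cartan_dual h))
    (X : cartan_dual h -> L) (n : cartan_dual h -> cartan_dual h -> R) :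
  semisimple L ->
  cartan_subalgebra h ->
  simple_system Sigma ->
  {subset Theta <= Sigma} ->
  weyl_basis X n ->
  isotropy_irreducible Sigma Theta ->
  forall J : L -> L,
    invariant_almost_complex Sigma Theta X J ->
    invariant_complex Sigma Theta X J.
Proof.
move=> ssL ch simple_Sigma _ weylX /pcard_eqP[f] J iacJ; split=> // x y mx my.
have [_ [a0 pa0 <-] _] : exists2 r, @t_roots_pos _ _ _ Sigma Theta r & f r = 0%N.
  by have [r tr fr] := @surj _ _ _ _ f 0%N isT; exists r.
have [H tH Ha0] := t_Theta_separates ssL ch weylX pa0.1.
(* The bijection [f] onto a one-point set sends every positive t-root to 0, so by injectivity all
   restrictions to [t_Theta] equal that of [a0]. *)
have Hc a : R_M_pos Sigma Theta a -> dual_eval a H = dual_eval a0 H.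
  have tpos b : R_M_pos Sigma Theta b -> @t_roots_pos _ _ _ Sigma Theta (k_restr b).
    by move=> pb; exists b.
  have f0 b : R_M_pos Sigma Theta b -> f (k_restr b) = 0%N.
    by move=> /tpos/(@funS _ _ _ _ f) /=; rewrite ltnS leqn0 => /eqP.
  move=> pa; have /eq_sigLP : k_restr (Theta := Theta) a = k_restr a0.
    have := @inj _ _ _ f; apply; [exact/mem_set/tpos | exact/mem_set/tpos |].
    exact: etrans (f0 _ pa) (esym (f0 _ pa0)).
  by apply; rewrite inE.
have lie0 u v : m_Theta Sigma Theta X u -> m_Theta Sigma Theta X v ->
    lie_m Sigma Theta X u v = 0.
  exact: (lie_m_eq0 ssL ch weylX simple_Sigma tH Ha0 Hc).
(* Linearity of [J] is only available on [m_Theta]; it is applied there to 0 and 0. *)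
have J0 : J 0 = 0.
  have := iac_linear iacJ 1 (real_span0 _) (real_span0 _).
  by rewrite scaler0 addr0 scale1r -[LHS]addr0 => /addrI.
have [mJx mJy] := (iac_stable iacJ mx, iac_stable iacJ my).
by rewrite /nijenhuis !lie0 // J0 oppr0 !addr0 scaler0.
Qed.
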